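(* There is a cocomparability graph $G$ such that $|V(\mathcal{H}(G))|\ge 2^{n/6}+2n/3-2$, where $n=|V(G)|$.
   Context: A graph is a cocomparability graph iff it admits an ordering $\sigma$ of its vertices such that whenever $\sigma(x)<\sigma(y)<\sigma(z)$ and $xz$ is an edge, then $xy$ or $yz$ is an edge. A graph is Helly if every family of pairwise intersecting disks $D(v,r)=\{u:d(u,v)\le r\}$ (shortest-path metric) has a common vertex. The injective hull $\mathcal{H}(G)$ of a connected graph $G$ is the unique minimal Helly graph containing $G$ as an isometric subgraph (equivalently, the graph on functions $f:V(G)\to\mathbb{Z}_{\ge0}$ with $f(x)+f(y)\ge d_G(x,y)$ for all $x,y$ and for each $x$ some $y$ with equality, adjacency meaning sup-norm distance 1). *)

(* Defs.v *)
From mathcomp Require Import all_boot.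
Set Implicit Arguments.
Unset Strict Implicit.
Unset Printing Implicit Defensive.

Record sgraph := SGraph {
  vertex :> finType;
  adj : rel vertex;
  adj_sym : symmetric adj;
  adj_irrefl : irreflexive adj
}.

Section GraphNotions.
Variable G : sgraph.

Definition gconnected : Prop := forall x y : G, connect (@adj G) x y.

Definition has_walk (k : nat) (x y : G) : bool :=
  [exists p : k.-tuple G, path (@adj G) x p && (last x p == y)].

(* The least length of a walk from x to y.  Two vertices joined by a walk are
   joined by one of length < #|G|; if there is none, [find] returns #|G|. *)
Definition gdist (x y : G) : nat :=
  find (fun k => has_walk k x y) (iota 0 #|G|).

Definition disk (v : G) (r : nat) : {set G} := [set u | gdist u v <= r].

(* A family of disks is given by the set F of its (center, radius) pairs. *)
Definition helly : Prop :=
  forall F : G -> nat -> Prop,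
    (forall v r w s, F v r -> F w s -> disk v r :&: disk w s != set0) ->
    exists u : G, forall v r, F v r -> u \in disk v r.

(* An injective map into 'I_#|G| is a bijection, i.e. a vertex ordering. *)
Definition cocomparability : Prop :=
  exists2 sigma : G -> 'I_#|G|, injective sigma &
    forall x y z : G, sigma x < sigma y -> sigma y < sigma z ->
      adj x z -> adj x y || adj y z.

End GraphNotions.

Definition isometric (G H : sgraph) (i : G -> H) : Prop :=
  forall x y : G, gdist (i x) (i y) = gdist x y.

Definition helly_extension (G H : sgraph) (i : G -> H) : Prop :=
  [/\ gconnected H, helly H & isometric i].

(* A subgraph K of H (not necessarily induced) is presented as an injective
   graph homomorphism j : K -> H; it is all of H exactly when j is onto and
   reflects adjacency. *)
Definition injective_hull (G H : sgraph) (i : G -> H) : Prop :=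
  helly_extension i /\
  forall (K : sgraph) (i' : G -> K) (j : K -> H),
    helly_extension i' ->
    injective j -> {homo j : x y / adj x y} -> j \o i' =1 i ->
    bijective j /\ {mono j : x y / adj x y}.

(* Main.v *)
(** The functions [f] with [f x + f y >= d(x,y)] that are pointwise minimal form,
    under the sup metric, a hyperconvex integer-valued space: the pointwise
    minimum of the [f_i + r_i] dominates a minimal function lying in every ball
    [B(f_i, r_i)].  Hyperconvexity yields geodesics, so the sup metric is the
    graph metric of a Helly graph, and a Helly graph [K] with [G <= K <= hull]
    must contain every such [f], as a common vertex of the disks [D(x, f x)].

    For the lower bound, take three cliques [a_i], [c_i], [b_i] ([i < k]), with
    [a_i ~ c_j] iff [i = j] and [c_i ~ b_j] iff [i <> j].  Listing them clique by
    clique is a cocomparability ordering, as no [a] is adjacent to a [b].  The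
    only pairs at distance 3 are the [a_i, b_i], so for each set [S] of indices
    the values [f a_i], [f b_i] in [{1, 2}] with sum 3 extend to an extremal
    function: the hull has at least [2^k] vertices, with [n = 3k]. *)
Require Import Defs.
From mathcomp Require Import all_boot all_order all_algebra.
From mathcomp Require Import all_classical all_reals all_analysis.
From mathcomp Require Import zify lra.
Set Implicit Arguments.
Unset Strict Implicit.
Unset Printing Implicit Defensive.
Import Order.TTheory GRing.Theory Num.Theory.

(** * Graph distance as a metric *)

Section Distance.
Variable G : sgraph.
Implicit Types x y z : G.

Lemma gdist_le_path x p : path (@adj G) x p -> gdist x (last x p) <= size p.
Proof.
move=> xp; rewrite leqNgt; apply/negP => lt_p.
have lt_pG : size p < #|G|.
  by apply: leq_trans lt_p _; rewrite -[leqRHS](size_iota 0) find_size.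
have := before_find 0 lt_p; rewrite nth_iota // add0n.
suff -> : has_walk (size p) x (last x p) by [].
by apply/existsP; exists (in_tuple p); rewrite xp eqxx.
Qed.

Lemma gdistxx x : gdist x x = 0.
Proof. by apply/eqP; rewrite -leqn0 (gdist_le_path (p := [::])). Qed.

Lemma gdist_le1 x y : (x == y) || adj x y -> gdist x y <= 1.
Proof.
case/orP => [/eqP-> | xy]; first by rewrite gdistxx.
by apply: (gdist_le_path (p := [:: y])); rewrite /= xy.
Qed.

Lemma gdist_max x y : gdist x y <= #|G|.
Proof. by rewrite -[leqRHS](size_iota 0) find_size. Qed.

Hypothesis Gconn : gconnected G.

Lemma gdist_path x y :
  exists p, [/\ path (@adj G) x p, last x p = y & size p = gdist x y].
Proof.
have hasw : has (fun k => has_walk k x y) (iota 0 #|G|).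
  have /connectP[p xp ->] := Gconn x y.
  case/shortenP: xp => p' xp' Up' _; apply/hasP; exists (size p').
    rewrite mem_iota /= add0n -[(size p').+1]/(size (x :: p')).
    by rewrite -(card_uniqP Up') max_card.
  by apply/existsP; exists (in_tuple p'); rewrite xp' eqxx.
have := nth_find 0 hasw; rewrite nth_iota; last by move: hasw; rewrite has_find size_iota.
case/existsP => p /andP[xp /eqP xpy].
by exists p; rewrite size_tuple.
Qed.

Lemma gdist_sym x y : gdist x y = gdist y x.
Proof.
suff le_sym (u v : G) : gdist u v <= gdist v u by apply/eqP; rewrite eqn_leq !le_sym.
have [p [vp <- <-]] := gdist_path v u.
have := gdist_le_path (x := last v p) (p := rev (belast v p)).
rewrite rev_path (eq_path (e' := @adj G)); last by move=> a b; rewrite /= adj_sym.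
move=> /(_ vp); rewrite size_rev size_belast.
by case: p {vp} => //= a p; rewrite rev_cons last_rcons.
Qed.

Lemma gdist_triangle y x z : gdist x z <= gdist x y + gdist y z.
Proof.
have [p [xp pE <-]] := gdist_path x y; have [q [yq <- <-]] := gdist_path y z.
rewrite -size_cat -[in last _ _]pE -last_cat; apply: gdist_le_path.
by rewrite cat_path xp pE.
Qed.

Lemma gdist_eq0 x y : gdist x y = 0 -> x = y.
Proof.
move=> d0; have [p [_ py sp]] := gdist_path x y.
by rewrite -py (size0nil (etrans sp d0)).
Qed.

Lemma gdist_eq1 x y : gdist x y = 1 -> adj x y.
Proof.
move=> d1; have [p [xp py sp]] := gdist_path x y.
by case: p {sp}(etrans sp d1) xp py => [|a []] //= _ /andP[xa _] <-.
Qed.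

(** Cut a shortest path after [r] steps, or at its end if it is shorter. *)
Lemma gdist_split x y r s : gdist x y <= r + s ->
  exists2 z, gdist z x <= r & gdist z y <= s.
Proof.
have [p [xp <- <-]] := gdist_path x y => le_p; move: xp.
rewrite -{1}(cat_take_drop r p) cat_path => /andP[xp pq].
exists (last x (take r p)).
  rewrite gdist_sym //; apply: leq_trans (gdist_le_path xp) _.
  by rewrite size_take_min geq_minl.
have pE : last (last x (take r p)) (drop r p) = last x p.
  by rewrite -last_cat cat_take_drop.
rewrite -pE; apply: leq_trans (gdist_le_path pq) _.
by rewrite size_drop leq_subLR.
Qed.

End Distance.

(** * Extremal functions *)

Section Hull.
Variable G : sgraph.
Hypothesis Gconn : gconnected G.
Implicit Types x y z : G.

Definition admissible (f : G -> nat) :=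
  [forall x, forall y, gdist x y <= f x + f y].

Definition extremal (f : G -> nat) :=
  admissible f && [forall x, exists y, f x + f y == gdist x y].

Lemma admissibleP f :
  reflect (forall x y, gdist x y <= f x + f y) (admissible f).
Proof. exact: 'forall_forallP. Qed.

(** Each value of an extremal function is at most some distance, hence at most [#|G|]; the bounded
    codomain loses nothing and makes this a finite type. *)
Definition hull_vertex :=
  {f : {ffun G -> 'I_#|G|.+1} | extremal (fun x => f x : nat)}.

Definition hval (f : hull_vertex) x : nat := val f x.

Lemma hval_inj f g : hval f =1 hval g -> f = g.
Proof. by move=> fg; apply/val_inj/ffunP => x; apply/val_inj/fg. Qed.

Lemma hval_adm f x y : gdist x y <= hval f x + hval f y.
Proof. by have /andP[/admissibleP fadm _] := valP f; apply: fadm. Qed.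

Lemma hval_tight f x : exists y, hval f x + hval f y = gdist x y.
Proof.
by have /andP[_ /forallP/(_ x)/existsP[y /eqP]] := valP f; exists y.
Qed.

Lemma hval_le f g : (forall x, hval f x <= hval g x) -> f = g.
Proof.
move=> le_fg; apply: hval_inj => x; apply/eqP; rewrite eqn_leq le_fg.
have [y gxy] := hval_tight g x.
by have := hval_adm f x y; have := le_fg y; lia.
Qed.

(** Induction on the sum of the values: while some [x] has no tight partner, [f x] can be lowered by
    one. *)
Lemma extremal_below (f : G -> nat) : admissible f ->
  exists h : hull_vertex, forall x, hval h x <= f x.
Proof.
have [n] := ubnP (\sum_x f x); elim: n => // n IHn in f *.
rewrite ltnS => le_fn fadm; have /admissibleP fge := fadm.
case: (boolP [forall x, exists y, f x + f y == gdist x y]) => [ftight|].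
  have lt_f x : f x < #|G|.+1.
    have /existsP[y /eqP] := forallP ftight x.
    by have := gdist_max x y; lia.
  pose g := [ffun x => Ordinal (lt_f x)].
  have gext : extremal (fun x => g x : nat).
    have gE : (fun x => g x : nat) =1 f by move=> x; rewrite ffunE.
    apply/andP; split; first by apply/admissibleP => x y; rewrite !gE.
    apply/forallP => x; have /existsP[y fxy] := forallP ftight x.
    by apply/existsP; exists y; rewrite !gE.
  by exists (exist _ g gext) => x; rewrite /hval /= ffunE.
case/forallPn => x /existsPn ltf.
have {}ltf y : gdist x y < f x + f y by rewrite ltn_neqAle eq_sym ltf fge.
(* Strictness at [y = x] gives positivity, so the truncated subtraction in [g] really lowers the
   sum. *)
have fx_gt0 : 0 < f x by have := ltf x; rewrite gdistxx; lia.
pose g y := f y - (y == x).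
have gadm : admissible g.
  apply/admissibleP => y z; rewrite /g.
  case: eqP => [->|_]; case: eqP => [->|_]; rewrite ?gdistxx ?subn0 //.
    by have := ltf z; lia.
  by rewrite gdist_sym //; have := ltf y; lia.
have [|h le_hg] := IHn g _ gadm; last first.
  by exists h => y; apply: leq_trans (le_hg y) (leq_subr _ _).
apply: leq_trans le_fn; rewrite (bigD1 x) //= [ltnRHS](bigD1 x) //=.
rewrite /g eqxx; have: \sum_(i | i != x) (f i - (i == x)) <= \sum_(i | i != x) f i.
  by apply: leq_sum => i _; apply: leq_subr.
by lia.
Qed.

(** * Hyperconvexity of the sup metric *)

Definition close k (f g : hull_vertex) :=
  [forall x, (hval f x <= hval g x + k) && (hval g x <= hval f x + k)].

Lemma closeP k f g :
  reflect (forall x, hval f x <= hval g x + k /\ hval g x <= hval f x + k)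
          (close k f g).
Proof. by apply: (iffP forallP) => fg x; apply/andP; apply: fg. Qed.

Lemma close_sym k f g : close k f g = close k g f.
Proof. by apply: eq_forallb => x; rewrite andbC. Qed.

Lemma closexx k f : close k f f.
Proof. by apply/closeP => x; rewrite leq_addr. Qed.

Lemma close_trans k l g f h : close k f g -> close l g h -> close (k + l) f h.
Proof.
move=> /closeP fg /closeP gh; apply/closeP => x.
by have := fg x; have := gh x; lia.
Qed.

Lemma close0 f g : close 0 f g -> f = g.
Proof. by move=> /closeP fg; apply: hval_le => x; have := fg x; lia. Qed.

Lemma hull_hyperconvex (F : hull_vertex -> nat -> Prop) :
  (forall f r g s, F f r -> F g s -> close (r + s) f g) ->
  exists h, forall f r, F f r -> close r f h.
Proof.
move=> Fclose.
(* The value [#|G|] guarantees that a minimum exists even for empty [F]; as it bounds all distances,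
   it cannot break admissibility. *)
pose P x n := `[< n = #|G| \/ exists f r, F f r /\ n = hval f x + r >].
have exP x : exists n, P x n by exists #|G|; apply/asboolP; left.
pose m x := ex_minn (exP x).
have mP x : m x = #|G| \/ exists f r, F f r /\ m x = hval f x + r.
  by rewrite /m; case: ex_minnP => n /asboolP.
have m_le x f r : F f r -> m x <= hval f x + r.
  rewrite /m; case: ex_minnP => n _ nmin Ffr; apply/nmin/asboolP.
  by right; exists f, r.
have madm : admissible m.
  apply/admissibleP => x y; have dG := gdist_max x y.
  have [mx|[f [r [Ff mx]]]] := mP x; first by lia.
  have [my|[g [s [Fg my]]]] := mP y; first by lia.
  have /closeP/(_ y) := Fclose _ _ _ _ Ff Fg.
  by have := hval_adm f x y; lia.
have [h le_hm] := extremal_below madm.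
have {madm le_hm} le_h x f r : F f r -> hval h x <= hval f x + r.
  by move=> Ff; apply: leq_trans (le_hm x) (m_le x f r Ff).
exists h => f r Ff; apply/closeP => x; split; last exact: le_h.
(* The lower bound on [h x] comes from the upper bound at a tight partner [y]: [f x = d(x,y) - f y
   <= h x + h y - f y <= h x + r]. *)
have [y fxy] := hval_tight f x.
by have := hval_adm h x y; have := le_h y f r Ff; lia.
Qed.

(** * The hull as a connected Helly graph *)

Definition hadj : rel hull_vertex := fun f g => (f != g) && close 1 f g.

Lemma hadj_sym : symmetric hadj.
Proof. by move=> f g; rewrite /hadj eq_sym close_sym. Qed.

Lemma hadj_irrefl : irreflexive hadj.
Proof. by move=> f; rewrite /hadj eqxx. Qed.

Definition hull := SGraph hadj_sym hadj_irrefl.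

(** Hyperconvexity applied to the ball of radius 1 at [f] and the ball of radius [k] at [g] yields
    the next vertex. It may be [f] itself, hence only an upper bound on the length. *)
Lemma close_path k f g : close k f g ->
  exists p, [/\ path hadj f p, last f p = g & size p <= k].
Proof.
elim: k f => [|k IHk] f fg; first by exists [::]; rewrite (close0 fg).
pose F h r := (h = f /\ r = 1) \/ (h = g /\ r = k).
have [|h hF] := @hull_hyperconvex F.
  by move=> ? ? ? ? [[-> ->]|[-> ->]] [[-> ->]|[-> ->]];
    rewrite ?closexx ?addn1 ?add1n // close_sym.
have fh : close 1 f h by apply: hF; left.
have /IHk[p [hp pg sp]] : close k h g by rewrite close_sym; apply: hF; right.
have [fhE|neq_fh] := eqVneq f h.
  by exists p; rewrite fhE; split=> //; apply: ltnW.
by exists (h :: p); rewrite /= /hadj neq_fh fh.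
Qed.

Lemma hull_connected : gconnected hull.
Proof.
move=> f g; have : close #|G| f g.
  apply/closeP => x; have lt_h (h : hull_vertex) : hval h x <= #|G|.
    by rewrite -ltnS /hval.
  by have := lt_h f; have := lt_h g; lia.
by case/close_path => p [fp <- _]; apply/connectP; exists p.
Qed.

Lemma hull_distE k (f g : hull) : (gdist f g <= k) = close k f g.
Proof.
apply/idP/idP => [|fg].
  have [p [+ <- <-]] := gdist_path hull_connected f g.
  elim: p k f {g} => [|h p IHp] [|k] f //=; rewrite ?closexx //.
  case/andP=> /andP[_ fh] hp; rewrite ltnS -[k.+1]add1n => /(IHp _ _ hp).
  exact: close_trans.
have [p [fp <- le_p]] := close_path fg.
exact: leq_trans (gdist_le_path (G := hull) fp) le_p.
Qed.

Lemma hull_helly : helly hull.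
Proof.
move=> F Fmeet; have [|h hF] := @hull_hyperconvex F.
  move=> f r g s Ff Fg; have /finset.set0Pn[u] := Fmeet _ _ _ _ Ff Fg.
  rewrite !inE !hull_distE => /andP[fu gu].
  by rewrite close_sym in fu; apply: close_trans fu gu.
by exists h => f r /hF; rewrite inE hull_distE close_sym.
Qed.

(** * The isometric embedding and minimality of the hull *)

Lemma gdist_extremal x :
  extremal (fun y => [ffun z => inord (gdist x z) : 'I_#|G|.+1] y : nat).
Proof.
have dE y : [ffun z => inord (gdist x z) : 'I_#|G|.+1] y = gdist x y :> nat.
  by rewrite ffunE inordK // ltnS gdist_max.
apply/andP; split.
  by apply/admissibleP => y z; rewrite !dE (gdist_sym Gconn x y) gdist_triangle.
by apply/forallP => y; apply/existsP; exists x; rewrite !dE gdistxx addn0 gdist_sym.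
Qed.

Definition hull_embed x : hull :=
  exist _ [ffun z => inord (gdist x z)] (gdist_extremal x).

Lemma hull_embedE x y : hval (hull_embed x) y = gdist x y.
Proof. by rewrite /hval ffunE inordK // ltnS gdist_max. Qed.

(** The sup distance from [f] to [d(x,-)] is [f x]: it is attained at [x], and a tight partner [z]
    of [y] gives [f y = d(y,z) - f z <= d(x,y) + f x]. *)
Lemma close_embed k (f : hull) x : close k f (hull_embed x) = (hval f x <= k).
Proof.
apply/closeP/idP => [/(_ x)|le_fk y]; first by rewrite hull_embedE gdistxx; lia.
rewrite hull_embedE; have [z fyz] := hval_tight f y.
have := hval_adm f x y; have := hval_adm f x z.
by have := gdist_triangle Gconn x y z; rewrite (gdist_sym Gconn y x); lia.
Qed.

Lemma hull_embed_isometric : isometric hull_embed.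
Proof.
move=> x y; apply/eqP; rewrite eqn_leq hull_distE close_embed hull_embedE leqnn.
by rewrite -(hull_embedE x y) -close_embed -hull_distE leqnn.
Qed.

Lemma hull_injective : injective_hull hull_embed.
Proof.
split.
  by split; [exact: hull_connected|exact: hull_helly|exact: hull_embed_isometric].
move=> K i j [Kconn Khelly iiso] jinj jhom ji.
have jlip a b : gdist (j a) (j b) <= gdist a b.
  have [p [ap <- <-]] := gdist_path Kconn a b.
  rewrite -last_map -(size_map j); apply: gdist_le_path.
  by rewrite path_map; apply: sub_path ap.
(* The value of [j u] at [x] is its distance to the image of [x], which [j] does not increase; so
   [j u] lies below [f], and extremal functions are minimal. *)
have below u (f : hull) : (forall x, gdist u (i x) <= hval f x) -> j u = f.
  move=> le_uf; apply: hval_le => x; rewrite -close_embed -hull_distE -ji /=.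
  exact: leq_trans (jlip _ _) (le_uf x).
have meet (a b : K) r s : gdist a b <= r + s -> disk a r :&: disk b s != finset.set0.
  by case/(gdist_split Kconn)=> z az bz; apply/finset.set0Pn; exists z; rewrite !inE az.
(* The disks of radius [f x] around [i x] pairwise meet because [f] is admissible and [i] isometric;
   any common vertex is sent to [f]. *)
have jsurj (f : hull) : exists2 u, j u = f & forall x, gdist u (i x) <= hval f x.
  have [|u uF] := Khelly (fun v r => exists2 x, v = i x & r = hval f x).
    move=> ? ? ? ? [x -> ->] [y -> ->]; apply: meet.
    by rewrite iiso hval_adm.
  have uf x : gdist u (i x) <= hval f x.
    by have := uF (i x) (hval f x); rewrite inE; apply; exists x.
  by exists u; first apply: below.
have jd a x : gdist a (i x) <= hval (j a) x.
  by have [u /jinj-> ] := jsurj (j a).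
split.
  apply: inj_card_bij => //; rewrite -(card_codom jinj).
  apply/subset_leq_card/fintype.subsetP => f _.
  by have [u <- _] := jsurj f; apply: codom_f.
move=> a b; apply/idP/idP => [|/jhom//]; case/andP=> neq_ab /closeP ab.
(* The disks with radii given by [j b] have [b] as only common vertex; adding the unit disk at [a]
   forces [b] to lie within distance 1 of [a]. *)
have [|u uF] := Khelly (fun v r => (v = a /\ r = 1) \/
                                   exists2 x, v = i x & r = hval (j b) x).
  have aux x : disk a 1 :&: disk (i x) (hval (j b) x) != finset.set0.
    by apply: meet; have := jd a x; have := ab x; lia.
  move=> ? ? ? ? [[-> ->]|[x -> ->]] [[-> ->]|[y -> ->]] //.
  - by apply: meet; rewrite gdistxx.
  - by rewrite finset.setIC.
  - by apply: meet; rewrite iiso hval_adm.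
have ub : u = b.
  apply/jinj/below => x.
  by have := uF (i x) (hval (j b) x); rewrite inE; apply; right; exists x.
have ba : gdist b a <= 1.
  by have := uF a 1; rewrite inE ub; apply; left.
move: ba; rewrite leq_eqVlt ltnS leqn0 => /orP[] /eqP.
  by move/(gdist_eq1 Kconn); rewrite adj_sym.
by move/(gdist_eq0 Kconn) => ba; rewrite ba eqxx in neq_ab.
Qed.

End Hull.

(** * The three-clique graph and its exponentially large hull *)

Section ThreeCliques.
Variable k : nat.
Hypothesis k_gt1 : 1 < k.

Definition tc_vertex : finType := ('I_3 * 'I_k)%type.
Implicit Types x y z : tc_vertex.

Definition layer x : nat := x.1.

Definition link x y :=
  [&& layer x == 0, layer y == 1 & x.2 == y.2] ||
  [&& layer x == 1, layer y == 2 & x.2 != y.2].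

(** Reflexive closure of adjacency, that is, distance at most 1; it spares the distinctness side
    conditions. *)
Definition near x y := [|| layer x == layer y, link x y | link y x].

Definition tc_adj : rel tc_vertex := fun x y => (x != y) && near x y.

Lemma near_sym : symmetric near.
Proof. by move=> x y; rewrite /near eq_sym orbCA orbC -orbA orbCA. Qed.

Lemma tc_adj_sym : symmetric tc_adj.
Proof. by move=> x y; rewrite /tc_adj eq_sym near_sym. Qed.

Lemma tc_adj_irrefl : irreflexive tc_adj.
Proof. by move=> x; rewrite /tc_adj eqxx. Qed.

Definition three_cliques := SGraph tc_adj_sym tc_adj_irrefl.

Lemma nearE x y : near x y = (x == y) || tc_adj x y.
Proof.
by rewrite /tc_adj; have [->|] := eqVneq x y; rewrite // /near eqxx.
Qed.

Definition va (i : 'I_k) : three_cliques := (inord 0, i).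
Definition vc (i : 'I_k) : three_cliques := (inord 1, i).
Definition vb (i : 'I_k) : three_cliques := (inord 2, i).

Lemma layer_va i : layer (va i) = 0. Proof. exact: inordK. Qed.
Lemma layer_vc i : layer (vc i) = 1. Proof. exact: inordK. Qed.
Lemma layer_vb i : layer (vb i) = 2. Proof. exact: inordK. Qed.
Definition layerE := (layer_va, layer_vc, layer_vb).

Variant tc_spec : three_cliques -> Prop :=
  | TcA i : tc_spec (va i)
  | TcC i : tc_spec (vc i)
  | TcB i : tc_spec (vb i).

Lemma tcP x : tc_spec x.
Proof.
case: x => l i; have [] : [\/ l = inord 0, l = inord 1 | l = inord 2].
  case: l => [[|[|[|//]]] lt_l]; [apply: Or31|apply: Or32|apply: Or33];
    by apply: val_inj; rewrite /= inordK.
all: by move=> ->; constructor.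
Qed.

Lemma near_aa i j : near (va i) (va j). Proof. by rewrite /near !layerE. Qed.
Lemma near_cc i j : near (vc i) (vc j). Proof. by rewrite /near !layerE. Qed.
Lemma near_bb i j : near (vb i) (vb j). Proof. by rewrite /near !layerE. Qed.
Lemma near_ac i j : near (va i) (vc j) = (i == j).
Proof. by rewrite /near /link !layerE /= !orbF. Qed.
Lemma near_cb i j : near (vc i) (vb j) = (i != j).
Proof. by rewrite /near /link !layerE /= !orbF. Qed.
Lemma near_ab i j : near (va i) (vb j) = false.
Proof. by rewrite /near /link !layerE. Qed.
Definition nearEs := (near_aa, near_cc, near_bb, near_ac, near_cb, near_ab).

Lemma other_index (i : 'I_k) : exists j, j != i.
Proof.
have [i0|i_neq0] := eqVneq (i : nat) 0.
  by exists (Ordinal k_gt1); rewrite -val_eqE /= i0.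
by exists (Ordinal (ltnW k_gt1)); rewrite -val_eqE /= eq_sym.
Qed.

Lemma near_connect x y : near x y -> connect tc_adj x y.
Proof. by rewrite nearE => /orP[/eqP->|/connect1]. Qed.

Lemma three_cliques_connected : gconnected three_cliques.
Proof.
have to_c i x : connect tc_adj x (vc i).
  case: (tcP x) => j.
  - apply: (connect_trans (y := vc j)); first by rewrite near_connect ?nearEs.
    by rewrite near_connect ?nearEs.
  - by rewrite near_connect ?nearEs.
  - have [l lj] := other_index j.
    apply: (connect_trans (y := vc l)); last by rewrite near_connect ?nearEs.
    by rewrite near_connect // near_sym nearEs.
move=> x y; apply: connect_trans (to_c x.2 x) _.
by rewrite (sym_connect_sym tc_adj_sym).
Qed.

Lemma near_gdist x y : (gdist (x : three_cliques) y <= 1) = near x y.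
Proof.
rewrite nearE; apply/idP/idP => [|/(gdist_le1 (G := three_cliques))//].
rewrite leq_eqVlt ltnS leqn0 orbC => /orP[] /eqP.
  by move/(gdist_eq0 three_cliques_connected)->; rewrite eqxx.
by move/(gdist_eq1 three_cliques_connected); rewrite /= => ->; rewrite orbT.
Qed.

Lemma near2_gdist z x y : near x z -> near z y -> gdist (x : three_cliques) y <= 2.
Proof.
rewrite -!near_gdist => xz zy.
apply: leq_trans (gdist_triangle three_cliques_connected z x y) _.
exact: leq_add xz zy.
Qed.

Lemma gdist_ab_neq i j : i != j -> gdist (va i) (vb j) <= 2.
Proof. by move=> ij; apply: (near2_gdist (z := vc i)); rewrite nearEs. Qed.

Lemma gdist_cb i j : gdist (vc i) (vb j) <= 2.
Proof.
have [l lj] := other_index j.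
by apply: (near2_gdist (z := vc l)); rewrite nearEs.
Qed.

Lemma gdist_ac i j : gdist (va i) (vc j) <= 2.
Proof. by apply: (near2_gdist (z := vc i)); rewrite nearEs. Qed.

Lemma gdist_ab_eq i : gdist (va i) (vb i) = 3.
Proof.
apply/eqP; rewrite eqn_leq; apply/andP; split.
  apply: leq_trans (gdist_triangle three_cliques_connected (vc i) _ _) _.
  by apply: (@leq_add _ _ 1 2); rewrite ?near_gdist ?nearEs ?gdist_cb.
(* Distance at most 2 would give a vertex near both ends, but outside its own clique [va i] sees
   only [vc i], which is not near [vb i]. *)
rewrite ltnNge; apply/negP => /(@gdist_split _ three_cliques_connected _ _ 1 1).
case=> z; rewrite !near_gdist; case: (tcP z) => j; rewrite ?nearEs //.
  by rewrite near_sym nearEs => /eqP->; rewrite eqxx.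
by rewrite near_sym nearEs.
Qed.

(* The value at [c_i] need not be extremal: an extremal function below this one
   already agrees with it on every [a_i] and [b_i], where the sum 3 is tight. *)
Definition half_cover (S : {set 'I_k}) (x : three_cliques) : nat :=
  if layer x == 0 then (x.2 \notin S).+1
  else if layer x == 1 then 1 else (x.2 \in S).+1.

(** All values are at least 1, which settles distances up to 2; the pairs at distance 3 have values
    1 and 2. *)
Lemma half_cover_admissible S : admissible (half_cover S).
Proof.
have sym := gdist_sym three_cliques_connected.
have near12 x y : near x y -> gdist (x : three_cliques) y <= 2.
  by rewrite -near_gdist => /leq_trans->.
have ab i j : gdist (va i) (vb j) <= half_cover S (va i) + half_cover S (vb j).
  rewrite /half_cover !layerE /=; have [->|/gdist_ab_neq] := eqVneq i j.
    by rewrite gdist_ab_eq; case: (_ \in _).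
  by move/leq_trans->; rewrite // addSn addnS.
have ge2 x y : gdist (x : three_cliques) y <= 2 ->
    gdist (x : three_cliques) y <= half_cover S x + half_cover S y.
  have ge1 z : 0 < half_cover S z by rewrite /half_cover; case: ifP => // _; case: ifP.
  by move/leq_trans->; rewrite // -[2]/(1 + 1) leq_add.
apply/admissibleP => x y; case: (tcP x) => i; case: (tcP y) => j.
- by rewrite ge2 ?near12 ?nearEs.
- by rewrite ge2 ?gdist_ac.
- exact: ab.
- by rewrite sym addnC ge2 ?gdist_ac.
- by rewrite ge2 ?near12 ?nearEs.
- by rewrite ge2 ?gdist_cb.
- by rewrite sym addnC ab.
- by rewrite sym addnC ge2 ?gdist_cb.
- by rewrite ge2 ?near12 ?nearEs.
Qed.

Lemma three_cliques_hull_card : 2 ^ k <= #|hull three_cliques|.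
Proof.
pose phi (h : hull three_cliques) : {set 'I_k} :=
  finset (fun i => hval h (va i) == 1).
have <- : #|powerset [set: 'I_k]%SET| = 2 ^ k.
  by rewrite card_powerset cardsT card_ord.
apply: leq_trans (leq_imset_card phi predT).
apply/subset_leq_card/fintype.subsetP => S _; apply/imsetP.
have [h le_h] := extremal_below three_cliques_connected (half_cover_admissible S).
exists h => //; apply/finset.setP => i; rewrite inE.
(* The sum at [va i] and [vb i] is at least 3 for [h] and exactly 3 for [half_cover S], so they
   agree there and [phi h] recovers [S]. *)
have := hval_adm h (va i) (vb i); rewrite gdist_ab_eq.
have := le_h (va i); have := le_h (vb i); rewrite /half_cover !layerE /=.
by case: (i \in S) => /=; lia.
Qed.

Lemma three_cliques_card : #|three_cliques| = 3 * k.
Proof. by rewrite card_prod !card_ord. Qed.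

Lemma three_cliques_cocomparability : cocomparability three_cliques.
Proof.
have lt_s x : layer x * k + x.2 < #|three_cliques|.
  rewrite three_cliques_card; have : layer x < 3 by rewrite /layer.
  by have := ltn_ord x.2; nia.
have s_div x : (layer x * k + x.2) %/ k = layer x.
  by rewrite divnMDl ?divn_small ?addn0 // ltnW.
exists (fun x => Ordinal (lt_s x)) => [x y|x y z].
  move=> /(congr1 val) /= eq_s; have eq_l : layer x = layer y.
    by rewrite -(s_div x) eq_s s_div.
  move: eq_s; rewrite eq_l => /addnI; move: eq_l; case: x y => [l i] [l' j].
  by rewrite /layer /= => /val_inj-> /val_inj->.
have mono u v : layer u * k + u.2 < layer v * k + v.2 -> layer u <= layer v.
  by move/ltnW/(leq_div2r k); rewrite !s_div.
move=> /= lt_xy lt_yz; have [le_xy le_yz] := (mono _ _ lt_xy, mono _ _ lt_yz).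
have neq_xy : x != y by apply: contraTneq lt_xy => ->; rewrite ltnn.
have neq_yz : y != z by apply: contraTneq lt_yz => ->; rewrite ltnn.
rewrite /tc_adj neq_xy neq_yz /= => /andP[_ nxz].
(* The ends of an edge are at most one layer apart, so the layer of [y], lying between theirs,
   equals one of them. *)
have : (layer x == layer y) || (layer y == layer z).
  by move: nxz; rewrite /near /link; lia.
by rewrite /near => /orP[] ->; rewrite ?orbT.
Qed.

End ThreeCliques.

(** * Numerical comparison and conclusion *)

Lemma exp2_bound m : 0 < m -> 2 ^ m + 4 * m <= 2 ^ (2 * m) + 2.
Proof.
rewrite expnM; elim: m => // -[|m] IHm _ //.
by have := IHm isT; rewrite !(expnS _ m.+1); have := expn_gt0 2 m.+1; lia.
Qed.

Local Open Scope ring_scope.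

Theorem theorem7 (R : realType) (N : nat) :
  exists G : sgraph,
    [/\ (N <= #|G|)%N, gconnected G, cocomparability G &
        exists (H : sgraph) (i : G -> H),
          injective_hull i /\
          (2 : R) `^ (#|G|%:R / 6) + 2 * #|G|%:R / 3 - 2 <= #|H|%:R].
Proof.
(* Cliques of size [2 * m] give [n = 6 * m], so [n / 6 = m] and [2 * n / 3 = 4 * m] are integers. *)
pose m := N.+1; have k_gt1 : (1 < 2 * m)%N by rewrite /m; lia.
have conn := three_cliques_connected k_gt1.
have cardE := three_cliques_card (2 * m).
exists (three_cliques (2 * m)); split=> //.
- by rewrite cardE /m; lia.
- exact: three_cliques_cocomparability.
exists (hull (three_cliques (2 * m))), (@hull_embed _ conn).
split; first exact: hull_injective.
have nE : #|three_cliques (2 * m)|%:R = 6 * m%:R :> R.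
  by rewrite cardE mulnA natrM.
have -> : #|three_cliques (2 * m)|%:R / 6 = m%:R :> R by rewrite nE; lra.
rewrite powR_mulrn // nE.
have : (2 ^ m + 4 * m <= #|hull (three_cliques (2 * m))| + 2)%N.
  by apply: leq_trans (exp2_bound _) _; rewrite // leq_add2r three_cliques_hull_card.
by rewrite -(ler_nat R) !natrD natrM natrX; lra.
Qed.
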